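(* Let $(M,J,g)$ be a $(J^2=\pm1)$-metric manifold, i.e. a manifold with an $(\alpha,\varepsilon)$-structure $(J,g)$, $\alpha,\varepsilon\in\{-1,1\}$. If the Levi Civita connection $\nabla^{\mathrm g}$ of $g$ and the tensor field $J$ satisfy $$(\nabla^{\mathrm g}_XJ)Y-(\nabla^{\mathrm g}_YJ)X=0,\quad\forall X,Y\in\mathfrak{X}(M),$$ then $(M,J,g)$ is a Kähler type manifold, i.e. $\nabla^{\mathrm g}J=0$.
   Context: $M$ is a smooth manifold, $\mathfrak{X}(M)$ is the set of vector fields on $M$, and $Id$ is the identity tensor field. For $\alpha,\varepsilon\in\{-1,1\}$, an $(\alpha,\varepsilon)$-structure on $M$ is a pair $(J,g)$ of a $(1,1)$-tensor field $J$ and a semi-Riemannian metric $g$ with $J^2=\alpha Id$ and $g(JX,JY)=\varepsilon g(X,Y)$ for all $X,Y\in\mathfrak{X}(M)$; then $(M,J,g)$ is called a $(J^2=\pm1)$-metric manifold. If $\varepsilon=1$, $g$ is Riemannian; if $\varepsilon=-1$, $g$ has signature $(n,n)$ with $\dim M=2n$; if $\alpha=\varepsilon=1$, the trace of $J$ is assumed to vanish (so $\dim M$ is even). $(M,J,g)$ is a Kähler type manifold if $\nabla^{\mathrm g}J=0$. *)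

(* Defs.v *)
From HB Require Import structures.
From mathcomp Require Export all_boot all_order all_algebra.
From mathcomp Require Export all_classical all_reals all_analysis.

Set Implicit Arguments.
Unset Strict Implicit.
Unset Printing Implicit Defensive.

Export Order.TTheory GRing.Theory Num.Theory.
Export numFieldNormedType.Exports.

Local Open Scope classical_set_scope.
Local Open Scope ring_scope.

(* Only meaningful for open U; functions are total, and only their values on U
   matter. *)
Fixpoint Ck (R : realType) (V W : normedModType R) (k : nat)
    (U : set V) (f : V -> W) : Prop :=
  match k with
  | 0 => forall x, U x -> {for x, continuous f}
  | k'.+1 => (forall x, U x -> differentiable f x) /\
             (forall v : V, Ck k' U (fun x => 'D_v f x))
  end.

Definition smooth_on (R : realType) (V W : normedModType R)
    (U : set V) (f : V -> W) : Prop := forall k, Ck k U f.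

(* A homeomorphism from the open set [dom] onto an open subset of R^n; [fwd]
   and [bwd] are total, their values outside [dom] and [img] are irrelevant. *)
Record chart (R : realType) (n : nat) (T : topologicalType) := Chart {
  dom : set T;
  fwd : T -> 'cV[R]_n;
  bwd : 'cV[R]_n -> T;
  chart_open_dom : open dom;
  chart_open_img : open (fwd @` dom);
  chart_fwdK : forall p, dom p -> bwd (fwd p) = p;
  chart_fwd_cont : forall p, dom p -> {for p, continuous fwd};
  chart_bwd_cont : forall x, (fwd @` dom) x -> {for x, continuous bwd} }.

Definition img (R : realType) (n : nat) (T : topologicalType)
  (c : chart R n T) : set 'cV[R]_n := fwd c @` dom c.

Record smoothManifold (R : realType) (n : nat) := SmoothManifold {
  points :> topologicalType;
  atlas : set (chart R n points);
  manifold_hausdorff : hausdorff_space points;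
  manifold_second_countable : @second_countable points;
  atlas_cover : forall p : points, exists c, atlas c /\ dom c p;
  atlas_compat : forall c d, atlas c -> atlas d ->
    smooth_on (fwd c @` (dom c `&` dom d)) (fwd d \o bwd c) }.

Section TensorFields.
Variables (R : realType) (n : nat) (M : smoothManifold R n).

(* T_pM is modelled by R^n: a tangent vector at p is given by its components in
   the chart [chart_at p], chosen once and for all among the charts around p.
   Linear maps and bilinear forms on T_pM are thus n x n matrices, and all
   statements about smoothness refer to components in an arbitrary chart. *)
Definition chart_at (p : M) : chart R n M := sval (cid (atlas_cover p)).

(* The differential at p of the chart c: the components in c of v : T_pM. *)
Definition chart_diff (c : chart R n M) (p : M) (v : 'cV[R]_n) : 'cV[R]_n :=
  'D_v (fwd c \o bwd (chart_at p)) (fwd (chart_at p) p).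

(* The coordinate vector d/dx^i of the chart c, as an element of T_pM. *)
Definition coord_vec (c : chart R n M) (p : M) (i : 'I_n) : 'cV[R]_n :=
  'D_(delta_mx i 0) (fwd (chart_at p) \o bwd c) (fwd c p).

Definition smooth_fun (f : M -> R) : Prop :=
  forall c, atlas c -> smooth_on (img c) (f \o bwd c).

Definition local_rep (c : chart R n M) (X : M -> 'cV[R]_n) :
    'cV[R]_n -> 'cV[R]_n :=
  fun x => chart_diff c (bwd c x) (X (bwd c x)).

Definition vector_field (X : M -> 'cV[R]_n) : Prop :=
  forall c, atlas c -> smooth_on (img c) (local_rep c X).

Definition tensor_field11 (J : M -> 'M[R]_n) : Prop :=
  forall c, atlas c -> forall j : 'I_n,
    smooth_on (img c) (local_rep c (fun p => J p *m coord_vec c p j)).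

(* g(X, Y) *)
Definition pairing (g : M -> 'M[R]_n) (X Y : M -> 'cV[R]_n) : M -> R :=
  fun p => ((X p)^T *m g p *m Y p) 0 0.

Definition tensor_field02 (g : M -> 'M[R]_n) : Prop :=
  forall c, atlas c -> forall i j : 'I_n,
    smooth_on (img c)
      (pairing g (fun p => coord_vec c p i) (fun p => coord_vec c p j)
         \o bwd c).

(* J X *)
Definition tapp (J : M -> 'M[R]_n) (X : M -> 'cV[R]_n) : M -> 'cV[R]_n :=
  fun p => J p *m X p.

(* The derivative X(f). *)
Definition vf_deriv (X : M -> 'cV[R]_n) (f : M -> R) : M -> R :=
  fun p => 'D_(X p) (f \o bwd (chart_at p)) (fwd (chart_at p) p).

(* [X, Y]^i = X^j d_j Y^i - Y^j d_j X^i in the chart [chart_at p]. *)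
Definition lie_bracket (X Y : M -> 'cV[R]_n) : M -> 'cV[R]_n :=
  fun p => let c := chart_at p in
    'D_(X p) (local_rep c Y) (fwd c p) - 'D_(Y p) (local_rep c X) (fwd c p).

End TensorFields.

Definition has_signature (R : realType) (n r s : nat) (G : 'M[R]_n) : Prop :=
  (r + s)%N = n /\
  exists2 P : 'M[R]_n, P \in unitmx &
    P^T *m G *m P = diag_mx (\row_(i < n) (if (i < r)%N then 1 else -1)).

Section Structures.
Variables (R : realType) (n : nat) (M : smoothManifold R n).

Record semi_riemannian (g : M -> 'M[R]_n) : Prop := {
  metric_tensor : tensor_field02 g;
  metric_sym : forall p, (g p)^T = g p;
  metric_nondeg : forall p, g p \in unitmx;
  metric_signature : exists r s, forall p, has_signature r s (g p) }.

Definition positive_definite (g : M -> 'M[R]_n) : Prop :=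
  forall p (v : 'cV[R]_n), v != 0 -> 0 < (v^T *m g p *m v) 0 0.

(* The (alpha, eps)-structures, for alpha, eps in {-1, 1}. *)
Record alpha_eps_structure (alpha eps : R) (J g : M -> 'M[R]_n) : Prop := {
  str_tensor : tensor_field11 J;
  str_metric : semi_riemannian g;
  str_sqr : forall p, J p *m J p = alpha%:M;
  str_compat : forall X Y, vector_field X -> vector_field Y ->
    forall p, pairing g (tapp J X) (tapp J Y) p = eps * pairing g X Y p;
  str_riemannian : eps = 1 -> positive_definite g;
  str_neutral : eps = -1 ->
    exists m, n = m.*2 /\ forall p, has_signature m m (g p);
  str_trace : alpha = 1 -> eps = 1 -> forall p, \tr (J p) = 0 }.

(* Connections are total functions; only their values on smooth vector fields
   matter. *)
Definition connection := (M -> 'cV[R]_n) -> (M -> 'cV[R]_n) -> M -> 'cV[R]_n.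

Record affine_connection (nabla : connection) : Prop := {
  conn_smooth : forall X Y, vector_field X -> vector_field Y ->
    vector_field (nabla X Y);
  conn_addl : forall X X' Y,
    vector_field X -> vector_field X' -> vector_field Y ->
    forall p, nabla (fun q => X q + X' q) Y p = nabla X Y p + nabla X' Y p;
  conn_scalel : forall f X Y,
    smooth_fun f -> vector_field X -> vector_field Y ->
    forall p, nabla (fun q => f q *: X q) Y p = f p *: nabla X Y p;
  conn_addr : forall X Y Y',
    vector_field X -> vector_field Y -> vector_field Y' ->
    forall p, nabla X (fun q => Y q + Y' q) p = nabla X Y p + nabla X Y' p;
  conn_leibniz : forall f X Y,
    smooth_fun f -> vector_field X -> vector_field Y ->
    forall p, nabla X (fun q => f q *: Y q) p =
              vf_deriv X f p *: Y p + f p *: nabla X Y p }.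

Record levi_civita (g : M -> 'M[R]_n) (nabla : connection) : Prop := {
  lc_connection : affine_connection nabla;
  lc_metric : forall X Y Z,
    vector_field X -> vector_field Y -> vector_field Z ->
    forall p, vf_deriv X (pairing g Y Z) p =
              pairing g (nabla X Y) Z p + pairing g Y (nabla X Z) p;
  lc_torsion_free : forall X Y, vector_field X -> vector_field Y ->
    forall p, nabla X Y p - nabla Y X p = lie_bracket X Y p }.

(* (nabla_X J) Y *)
Definition nabla_tensor (nabla : connection) (J : M -> 'M[R]_n)
    (X Y : M -> 'cV[R]_n) : M -> 'cV[R]_n :=
  fun p => nabla X (tapp J Y) p - tapp J (nabla X Y) p.

(* nabla J = 0, to be used with the Levi-Civita connection of the metric. *)
Definition kahler_type (nabla : connection) (J : M -> 'M[R]_n) : Prop :=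
  forall X Y, vector_field X -> vector_field Y ->
  forall p, nabla_tensor nabla J X Y p = 0.

End Structures.

(* Main.v *)
From HB Require Import structures.
Require Import Defs.
From mathcomp Require Import ring lra.

(** Write S(X, Y) for (nabla_X J) Y and T(X, Y, Z) for g(S(X, Y), Z), and put
s = alpha * eps. From J^2 = alpha and the compatibility of J with g, the field J
is s-self-adjoint for g; differentiating this relation with the metric
connection shows that T is s-symmetric in its last two arguments
([nablaJ_adjoint]). The hypothesis says that T is symmetric in its first two
arguments.

If s = -1, T is symmetric in one pair of adjacent arguments and skew in the
other, and the braid relation of the two transpositions gives T = -T. If
s = 1, T is totally symmetric. Differentiating J^2 = alpha gives
S(X, JY) = - J S(X, Y) ([nablaJ_anticomm]), hence, J being self-adjoint,
T(X, JY, Z) = - T(X, Y, JZ) ([nablaJ_skew]): moving J from one slot to another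
changes the sign. By total symmetry J can travel from Z to Y, to X and back to Z,
which changes the sign three times, so that T(X, Y, JZ) = 0, and then
T = 0 because J is invertible. In both cases S(X, Y) is g-orthogonal to every
vector field.

To conclude that S(X, Y) vanishes, vector fields have to take every value at a
given point ([metric_eq0]). As g may be indefinite, testing against S(X, Y)
itself is not enough, and fields with a prescribed value have to be built by
cutting off a coordinate field ([vector_field_extension]). This takes the
calculus of C^k maps (stability under sums, products and composition), a
smooth bump function, and the chain rule for changes of charts. The same
calculus shows that J maps vector fields to vector fields
([vector_field_tapp]). *)

Set Implicit Arguments.
Unset Strict Implicit.
Unset Printing Implicit Defensive.

Local Open Scope classical_set_scope.
Local Open Scope ring_scope.

(** * Maps of class C^k between normed spaces *)

Section Calculus.
Variable R : realType.
Implicit Types V W : normedModType R.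

Lemma scale_is_bilinear W :
  bilinear_for
    (GRing.Scale.Law.clone _ _ *:%R _) (GRing.Scale.Law.clone _ _ *:%R _)
    (@GRing.scale R W).
Proof.
split=> [w|r] a x y /=; first by rewrite scalerDl scalerA.
by rewrite scalerDr !scalerA mulrC.
Qed.

HB.instance Definition _ W :=
  bilinear_isBilinear.Build R R W W _ _ (@GRing.scale R W) (scale_is_bilinear W).

Lemma differentiable_scale V W (k : V -> R) (f : V -> W) x :
  differentiable k x -> differentiable f x ->
  differentiable (fun y => k y *: f y) x.
Proof.
move=> dk df.
apply: (differentiable_comp (f := fun y => (k y, f y)) (g := fun q => q.1 *: q.2)).
  exact: differentiable_pair.
by apply: differentiable_bilin => p; exact: scale_continuous.
Qed.

Lemma derive_scale V W (k : V -> R) (f : V -> W) x v :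
  differentiable k x -> differentiable f x ->
  'D_v (fun y => k y *: f y) x = k x *: 'D_v f x + 'D_v k x *: f x.
Proof.
move=> dk df; rewrite deriveE; last exact: differentiable_scale.
rewrite (diff_comp (f := fun y => (k y, f y)) (g := fun q => q.1 *: q.2)).
- rewrite diff_pair//= diff_bilin/=; last by move=> p; exact: scale_continuous.
  by rewrite (deriveE v dk) (deriveE v df).
- exact: differentiable_pair.
- by apply: differentiable_bilin => p; exact: scale_continuous.
Qed.

(** The difference g - f vanishes near x, so it is o(h) with zero
differential, and g = (g - f) + f. *)
Lemma near_eq_differentiable V W (f g : V -> W) x :
  {near x, f =1 g} -> differentiable f x -> differentiable g x.
Proof.
move=> fg df; rewrite -[g](subrK f).
apply: (differentiableD _ df).
have fgx : f x = g x := nbhs_singleton fg.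
have h0 : (g - f) x = 0 by rewrite !fctE /= fgx subrr.
have E : (g - f) \o shift x = cst ((g - f) x) + (\0 : {linear V -> W}) +o_ 0 id.
  apply/eqaddoP => e e0; rewrite h0.
  have : \forall y \near (0 : V), f (y + x) = g (y + x).
    by move: fg; rewrite (near_shift 0 x) subr0.
  apply: filterS => y fgy /=.
  rewrite !fctE /= -fgy subrr add0r.
  by rewrite addr0 oppr0 normr0 mulr_ge0 // ltW.
have c0 : continuous (\0 : {linear V -> W}) by move=> y; exact: cvg_cst.
apply/diff_locallyP; split; last by rewrite (diff_unique c0 E).
by rewrite (diff_unique c0 E).
Qed.

Lemma Ck_eq V W k (U : set V) (f g : V -> W) : open U ->
  (forall x, U x -> f x = g x) -> Ck k U f -> Ck k U g.
Proof.
move=> oU; elim: k f g => [|k IH] f g fg.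
  move=> cf x Ux.
  have nfg : {near x, f =1 g} by apply: filterS (open_nbhs_nbhs (conj oU Ux)).
  rewrite /prop_for /continuous_at -(fg _ Ux).
  exact: cvg_trans (near_eq_cvg nfg) (cf _ Ux).
have nfg x : U x -> {near x, f =1 g}.
  by move=> Ux; apply: filterS (open_nbhs_nbhs (conj oU Ux)).
move=> [df Df]; split=> [x Ux|v].
  exact: near_eq_differentiable (nfg _ Ux) (df _ Ux).
by apply: IH (Df v) => x Ux; exact: near_eq_derive (nfg _ Ux).
Qed.

Lemma Ck_subset V W k (U U' : set V) (f : V -> W) :
  U `<=` U' -> Ck k U' f -> Ck k U f.
Proof.
move=> UU'; elim: k f => [|k IH] f; first by move=> cf x /UU'; exact: cf.
by move=> [df Df]; split=> [x /UU'|v]; [exact: df|exact: IH (Df v)].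
Qed.

(** Every clause of [Ck] concerns one point of the domain at a time, which makes
the property local even for neighbourhoods that are not open. *)
Lemma Ck_local V W k (U : set V) (f : V -> W) :
  (forall x, U x -> exists2 U', U' x & Ck k U' f) -> Ck k U f.
Proof.
elim: k f => [|k IH] f loc; first by move=> x /loc[U' U'x]; exact.
split=> [x /loc[U' U'x [df _]]|v]; first exact: df.
by apply: IH => x /loc[U' U'x [_ Df]]; exists U' => //; exact: Df.
Qed.

Lemma Ck_pred V W k (U : set V) (f : V -> W) : Ck k.+1 U f -> Ck k U f.
Proof.
elim: k f => [|k IH] f [df Df].
  by move=> x Ux; exact: differentiable_continuous (df _ Ux).
by split=> // v; exact: IH (Df v).
Qed.

Lemma Ck_cst V W k (U : set V) (w : W) : Ck k U (cst w).
Proof.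
elim: k w => [|k IH] w; first by move=> x _; exact: cvg_cst.
split=> [x _|v]; first exact: differentiable_cst.
have -> : (fun x => 'D_v (cst w) x) = cst 0.
  by apply/funext => x; rewrite derive_cst.
exact: IH.
Qed.

Lemma Ck_linear V V' W k (U : set V) (L : {linear V' -> W}) (f : V -> V') :
  open U -> continuous L -> Ck k U f -> Ck k U (L \o f).
Proof.
move=> oU cL; elim: k f => [|k IH] f.
  by move=> cf x Ux; apply: continuous_comp; [exact: cf|exact: cL].
move=> [df Df]; have dL y : differentiable L y by exact: linear_differentiable.
split=> [x Ux|v]; first by apply: differentiable_comp; [exact: df|].
apply: (Ck_eq (f := L \o 'D_v f)) (IH _ (Df v)) => // x Ux /=.
have dfx := df _ Ux; have dLf := differentiable_comp dfx (dL (f x)).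
rewrite /= (deriveE v dfx) (deriveE v dLf) (diff_comp dfx (dL (f x)))/=.
  by rewrite (diff_lin (f x) cL).
Qed.

Lemma Ck_add V W k (U : set V) (f g : V -> W) : open U ->
  Ck k U f -> Ck k U g -> Ck k U (fun x => f x + g x).
Proof.
move=> oU; elim: k f g => [|k IH] f g.
  by move=> cf cg x Ux; apply: cvgD; [exact: cf|exact: cg].
move=> [df Df] [dg Dg].
split=> [x Ux|v]; first by apply: differentiableD; [exact: df|exact: dg].
apply: (Ck_eq (f := fun x => 'D_v f x + 'D_v g x)) => //; last exact: IH (Df v) (Dg v).
by move=> x Ux; rewrite deriveD//; apply: diff_derivable; [exact: df|exact: dg].
Qed.

Lemma Ck_sum V W k (U : set V) n (f : 'I_n -> V -> W) : open U ->
  (forall i, Ck k U (f i)) -> Ck k U (fun x => \sum_(i < n) f i x).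
Proof.
move=> oU; elim: n f => [|n IH] f Cf.
  apply: (Ck_eq (f := cst 0)) => //; last exact: Ck_cst.
  by move=> x _; rewrite big_ord0.
apply: (Ck_eq (f := fun x => f ord0 x + \sum_(i < n) f (lift ord0 i) x)) => //.
  by move=> x _; rewrite big_ord_recl.
by apply: Ck_add => //; exact: IH.
Qed.

Lemma Ck_scale V W k (U : set V) (a : V -> R) (f : V -> W) : open U ->
  Ck k U a -> Ck k U f -> Ck k U (fun x => a x *: f x).
Proof.
move=> oU; elim: k a f => [|k IH] a f.
  by move=> ca cf x Ux; apply: cvgZ; [exact: ca|exact: cf].
move=> Ca Cf; have [da Da] := Ca; have [df Df] := Cf.
split=> [x Ux|v]; first by apply: differentiable_scale; [exact: da|exact: df].
apply: (Ck_eq (f := fun x => a x *: 'D_v f x + 'D_v a x *: f x)) => //.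
  by move=> x Ux; rewrite derive_scale//; [exact: da|exact: df].
apply: Ck_add => //; first exact: IH (Ck_pred Ca) (Df v).
exact: IH (Da v) (Ck_pred Cf).
Qed.

(** The derivative of g o f along v at x is the derivative of g along D_v f(x), a
direction that varies with x, whereas [Ck] speaks of fixed directions. Expanding
D_v f(x) in a finite basis of the middle space turns it into a combination of
fixed partial derivatives of g, whose coefficients are of class C^k. *)
Lemma Ck_comp V V' W k (U : set V) (U' : set V') m (e : 'I_m -> V')
    (phi : 'I_m -> {linear V' -> R}) (f : V -> V') (g : V' -> W) :
  (forall i, continuous (phi i)) -> (forall v, v = \sum_i phi i v *: e i) ->
  open U -> (forall x, U x -> U' (f x)) ->
  Ck k U f -> Ck k U' g -> Ck k U (g \o f).
Proof.
move=> cphi basis oU fU; elim: k g => [|k IH] g.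
  by move=> cf cg x Ux; apply: continuous_comp; [exact: cf|exact/cg/fU].
move=> Cf [dg Dg]; have [df Df] := Cf.
split=> [x Ux|v]; first by apply: differentiable_comp; [exact: df|exact/dg/fU].
pose h x := \sum_i phi i ('D_v f x) *: ('D_(e i) g \o f) x.
apply: (Ck_eq (f := h)) => // [x Ux|].
  have dfx := df _ Ux; have dgx := dg _ (fU _ Ux).
  rewrite /h (deriveE v (differentiable_comp dfx dgx)) (diff_comp dfx dgx)/=.
  rewrite -(deriveE v dfx) [in RHS](basis ('D_v f x)) linear_sum.
  by apply: eq_bigr => i _; rewrite linearZ /= (deriveE _ dgx).
apply: Ck_sum => // i; apply: Ck_scale => //.
  by apply: Ck_linear => //; exact: Df.
exact: IH (Ck_pred Cf) (Dg (e i)).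
Qed.

End Calculus.

(** * Flat functions on the real line *)

Section Flat.
Variable R : realType.

(** The powers of 1/t are included so that the span of the family is closed
under differentiation; [flat 0] is the classical smooth function vanishing exactly on
the nonpositive half-line. *)
Definition flat (m : nat) (t : R) : R :=
  if 0 < t then t^-1 ^+ m * expR (- t^-1) else 0.

(** Apply 1 + y <= e^y to y = s / (m + 1) and raise to the power m + 1. *)
Lemma expR_ge_pow (m : nat) (s : R) : 0 <= s ->
  s ^+ m.+1 <= m.+1%:R ^+ m.+1 * expR s.
Proof.
move=> s0; have m0 : 0 < m.+1%:R :> R by rewrite ltr0n.
have -> : expR s = expR (s / m.+1%:R) ^+ m.+1.
  by rewrite -expRM_natl mulrC divfK ?gt_eqF.
rewrite -exprMn lerXn2r ?nnegrE// ?mulr_ge0 ?expR_ge0 ?(ltW m0)//.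
rewrite mulrC -ler_pdivrMr//; apply: le_trans (expR_ge1Dx _).
by rewrite lerDr.
Qed.

Lemma flat_ge0 m t : 0 <= flat m t.
Proof.
rewrite /flat; case: ifPn => // t0.
by rewrite mulr_ge0 ?expR_ge0// exprn_ge0// invr_ge0 ltW.
Qed.

(** This linear bound serves at t = 0: it says that [flat m.+1], which is the
difference quotient of [flat m] at 0, tends to 0. *)
Lemma flat_le m t : flat m t <= m.+1%:R ^+ m.+1 * `|t|.
Proof.
rewrite /flat; case: ifPn => [t0|_]; last by rewrite mulr_ge0// exprn_ge0.
have s0 : 0 < t^-1 by rewrite invr_gt0.
rewrite gtr0_norm// expRN -(ler_pM2r s0) -[leRHS]mulrA mulfV ?gt_eqF// mulr1.
rewrite mulrAC -exprSr ler_pdivrMr ?expR_gt0//.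
exact: expR_ge_pow (ltW s0).
Qed.

Lemma is_derive_flat m (t : R) :
  is_derive t 1 (flat m) (flat m.+2 t - m%:R * flat m.+1 t).
Proof.
have [t0|t0|->] := ltgtP t 0.
- rewrite /flat ltNge (ltW t0)/= mulr0 subr0.
  apply: (near_eq_is_derive (f := cst 0)).
  near=> s; rewrite ltNge ltW//=; near: s; exact: lt_nbhsl.
  apply: (@near_eq_is_derive R R R (fun s : R => s^-1 ^+ m * expR (- s^-1))).
    near=> s; rewrite /flat ifT//; near: s; exact: lt_nbhsr.
  have tn0 : t != 0 by rewrite gt_eqF.
  rewrite /flat t0.
  have dV : is_derive t 1 (@GRing.inv R) (- t ^- 2).
    apply: is_derive_eq (is_deriveV tn0 (is_derive_id t 1)) _.
    by rewrite /GRing.scale/= mulr1.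
  (* flat m is u^m e^(-u) composed with u = 1/t *)
  have dE (u : R) : is_derive u 1 (fun s => s ^+ m * expR (- s))
      (m%:R * u ^+ m.-1 * expR (- u) - u ^+ m * expR (- u)).
    have dN : is_derive u 1 (expR \o -%R) (- expR (- u)).
      apply: is_derive_eq (is_derive1_comp (is_derive_expR _) (is_deriveNid _ _)) _.
      by rewrite mulrN1.
    have dX : is_derive u 1 (fun s : R => s ^+ m) (m%:R * u ^+ m.-1).
      apply: DeriveDef; first exact: exprn_derivable.
      by rewrite exp_derive /GRing.scale/= mulr1.
    apply: is_derive_eq (is_deriveM dX dN) _.
    by rewrite /GRing.scale/=; ring.
  apply: is_derive_eq (is_derive1_comp (dE _) dV) _.
  rewrite -exprVn; case: m {dE} => [|m] /=; first by ring.
  by rewrite !exprS; ring.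
- have cv : h^-1 *: ((flat m \o shift 0) (h *: 1) - flat m 0) @[h --> (0 : R)^'] --> 0.
    apply/cvgr0Pnorm_le => e e0; near=> h.
    rewrite /= addr0 /GRing.scale/= mulr1 [flat m 0]/flat ltxx subr0.
    have -> : h^-1 * flat m h = flat m.+1 h.
      by rewrite /flat; case: ifP => _; rewrite ?mulr0// exprS mulrA.
    rewrite ger0_norm ?flat_ge0//; apply: (le_trans (flat_le _ _)).
    have C0 : 0 < m.+2%:R ^+ m.+2 :> R by rewrite exprn_gt0.
    rewrite -ler_pdivlMl// mulrC ltW//; near: h.
    apply: dnbhs0_lt; exact: divr_gt0.
  rewrite /flat ltxx mulr0 subrr; apply: DeriveDef; first exact: cvgP cv.
  exact: cvg_lim cv.
Unshelve. all: by end_near. Qed.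

Lemma Ck_flat m k (U : set R) : open U -> Ck k U (flat m).
Proof.
move=> oU; elim: k m => [|k IH] m.
  move=> x _; apply: differentiable_continuous; apply/derivable1_diffP.
  by have [] := is_derive_flat m x.
have df x : differentiable (flat m) x.
  by apply/derivable1_diffP; have [] := is_derive_flat m x.
split=> [x _|v]; first exact: df.
apply: (Ck_eq (f := fun x => v *: (flat m.+2 x + (- m%:R) *: flat m.+1 x))) => //.
  move=> x _; rewrite (deriveE v (df x)).
  have -> : v = v *: (1 : R) by rewrite /GRing.scale/= mulr1.
  rewrite linearZ /= -deriveE//; have [_ ->] := is_derive_flat m x.
  by rewrite /GRing.scale/=; ring.
apply: Ck_scale => //; first exact: Ck_cst.
apply: Ck_add => //.
by apply: Ck_scale => //; exact: Ck_cst.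
Qed.

End Flat.

(** * Coordinates and bump functions *)

Lemma trmx_continuous (R : realType) m n :
  continuous (fun A : 'M[R]_(m, n) => A^T).
Proof.
move=> A; apply/(@cvg_ballP _ _ _ (nbhs A)) => e e0.
have := nbhsx_ballx A e e0.
by apply: filterS => B [_ AB]; split=> // i j; rewrite !mxE; exact: AB.
Qed.

Section Coordinates.
Variables (R : realType) (n : nat).

(** A coordinate as a named function, so that it can carry a linear structure. *)
Definition cV_coord (i : 'I_n) (v : 'cV[R]_n) : R := v i 0.

Lemma cV_coord_is_linear i : linear (cV_coord i).
Proof. by move=> a u v; rewrite /cV_coord !mxE. Qed.

HB.instance Definition _ i :=
  GRing.isLinear.Build R 'cV[R]_n R *%R (cV_coord i) (cV_coord_is_linear i).

Lemma cV_coord_continuous i : continuous (cV_coord i).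
Proof. exact: coord_continuous. Qed.

Lemma cV_sum_delta (v : 'cV[R]_n) : v = \sum_i cV_coord i v *: delta_mx i 0.
Proof.
rewrite [LHS]matrix_sum_delta; apply: eq_bigr => i _.
by rewrite big_ord1.
Qed.

Lemma smooth_coord (V : normedModType R) (U : set V) (f : V -> 'cV[R]_n) i :
  open U -> smooth_on U f -> smooth_on U (fun x => f x i 0).
Proof.
move=> oU sf k.
exact: (Ck_linear (L := cV_coord i) oU (@cV_coord_continuous i) (sf k)).
Qed.

Lemma smooth_comp (V W : normedModType R) (U : set V) (U' : set 'cV[R]_n)
    (f : V -> 'cV[R]_n) (g : 'cV[R]_n -> W) :
  open U -> (forall x, U x -> U' (f x)) ->
  smooth_on U f -> smooth_on U' g -> smooth_on U (g \o f).
Proof.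
move=> oU fU sf sg k.
exact: (Ck_comp cV_coord_continuous cV_sum_delta oU fU (sf k) (sg k)).
Qed.

Lemma smooth_comp_real (V W : normedModType R) (U : set V) (U' : set R)
    (f : V -> R) (g : R -> W) :
  open U -> (forall x, U x -> U' (f x)) ->
  smooth_on U f -> smooth_on U' g -> smooth_on U (g \o f).
Proof.
move=> oU fU sf sg k.
apply: (@Ck_comp R V R W k U U' 1 (fun=> 1) (fun=> idfun) f g _ _ oU fU (sf k) (sg k)).
  by move=> _ x; exact: cvg_id.
by move=> v; rewrite big_ord1 /GRing.scale/= mulr1.
Qed.

Definition bump (a : 'cV[R]_n) (r : R) (x : 'cV[R]_n) : R :=
  flat 0 (r ^+ 2 - \sum_i (x i 0 - a i 0) ^+ 2).

Lemma smooth_bump a r : smooth_on setT (bump a r).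
Proof.
have oT : open [set: 'cV[R]_n] by exact: openT.
apply: (@smooth_comp_real _ _ _ setT) => // [k|k]; last exact/Ck_flat/openT.
have sub i : Ck k setT (fun x : 'cV[R]_n => x i 0 - a i 0).
  apply: Ck_add => //; last exact: Ck_cst.
  apply: (smooth_coord i oT (f := id)) => {}k.
  case: k => [|k]; first by move=> x _; exact: cvg_id.
  split=> [x _|v].
    by apply: (linear_differentiable (f := idfun)) => y; exact: cvg_id.
  have -> : (fun x : 'cV[R]_n => 'D_v id x) = cst v.
    by apply/funext => x; rewrite derive_id.
  exact: Ck_cst.
apply: Ck_add => //; first exact: Ck_cst.
pose sq (x : 'cV[R]_n) := \sum_i (x i 0 - a i 0) *: (x i 0 - a i 0).
apply: (Ck_eq (f := fun x => (-1 : R) *: sq x)) => //.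
  by move=> x _; rewrite scaleN1r.
apply: Ck_scale => //; first exact: Ck_cst.
by apply: Ck_sum => // i; exact: Ck_scale.
Qed.

Lemma bump_center a r : r != 0 -> bump a r a != 0.
Proof.
move=> r0; rewrite /bump big1 ?subr0 => [|i _]; last by rewrite subrr expr0n.
by rewrite /flat exprn_even_gt0//= r0 expr0 mul1r gt_eqF// expR_gt0.
Qed.

Definition cube (a : 'cV[R]_n) (r : R) : set 'cV[R]_n :=
  [set x | forall i, `|x i 0 - a i 0| <= r].

Lemma bump_supp a r x : 0 <= r -> bump a r x != 0 -> cube a r x.
Proof.
move=> r0; rewrite /bump /flat; case: ifPn => [|_]; last by rewrite eqxx.
rewrite subr_gt0 => lt _ i.
rewrite -(ler_pXn2r (n := 2)) ?nnegrE// real_normK ?num_real//.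
apply: le_trans (ltW lt); rewrite (bigD1 i)//= lerDl.
by apply: sumr_ge0 => j _; exact: sqr_ge0.
Qed.

(** A product of segments; Tychonoff applies to row vectors, hence the
transposition. *)
Lemma cube_compact a r : compact (cube a r).
Proof.
have -> : cube a r = trmx @` [set v : 'rV[R]_n |
    forall i, `[a i 0 - r, a i 0 + r]%classic (v ord0 i)].
  rewrite eqEsubset; split => [x xa|_ [v va <-] i].
    exists x^T; last by rewrite trmxK.
    by move=> i; rewrite mxE /= in_itv/= -ler_distl.
  by rewrite mxE; have := va i; rewrite /= in_itv/= -ler_distl.
apply: continuous_compact; last first.
  apply: (@rV_compact R n (fun i => `[a i 0 - r, a i 0 + r]%classic)) => i.
  exact: segment_compact.
apply: continuous_subspaceT => v.
exact: trmx_continuous.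
Qed.

Lemma cube_nbhs a (U : set 'cV[R]_n) : nbhs a U ->
  exists2 r, 0 < r & cube a r `<=` U.
Proof.
move=> /nbhs_ballP[e /= e0 eU]; exists (e / 2); first by rewrite divr_gt0.
move=> x xa; apply: eU; split=> // i j; rewrite ord1.
apply: (@le_lt_trans _ _ (e / 2)); last first.
  by rewrite ltr_pdivrMr// mulr2n mulrDr mulr1 ltrDl.
by rewrite distrC; exact: xa.
Qed.
End Coordinates.

(** * Changes of charts *)

Lemma nbhs_of_open (T : topologicalType) (U : set T) x :
  open U -> U x -> nbhs x U.
Proof. by move=> oU Ux; apply: open_nbhs_nbhs. Qed.

Section Charts.
Variables (R : realType) (n : nat) (M : smoothManifold R n).
Implicit Types (c d e : chart R n M) (p : M).

Lemma img_bwd c x : img c x -> dom c (bwd c x) /\ fwd c (bwd c x) = x.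
Proof. by case=> p cp <-; rewrite chart_fwdK. Qed.

Lemma img_fwd c p : dom c p -> img c (fwd c p).
Proof. by move=> cp; exists p. Qed.

Lemma open_img c : open (img c).
Proof. exact: chart_open_img. Qed.

Lemma chart_atP p : atlas (chart_at p) /\ dom (chart_at p) p.
Proof. by rewrite /chart_at; case: cid. Qed.

(** This is fwd c @` (dom c `&` dom d), in a form whose openness is a preimage
statement. *)
Definition overlap c d : set 'cV[R]_n := img c `&` bwd c @^-1` dom d.

Lemma overlap_fwd c d p : dom c p -> dom d p -> overlap c d (fwd c p).
Proof. by move=> cp dp; split; [exact: img_fwd|rewrite /= chart_fwdK]. Qed.

Lemma open_preimage c (O : set M) : open O -> open (img c `&` bwd c @^-1` O).
Proof.
move=> oO; rewrite openE => x [cx Ox]; apply: (@filterI _ (nbhs x)).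
  by apply: open_nbhs_nbhs; split => //; exact: chart_open_img.
by apply: (chart_bwd_cont cx); exact: open_nbhs_nbhs.
Qed.

Lemma open_overlap c d : open (overlap c d).
Proof. exact/open_preimage/chart_open_dom. Qed.

Lemma smooth_transition c d : atlas c -> atlas d ->
  smooth_on (overlap c d) (fwd d \o bwd c).
Proof.
move=> ac ad k; apply: Ck_subset (atlas_compat ac ad k) => x [cx dx].
by have [cbx <-] := img_bwd cx; exists (bwd c x).
Qed.

(** The differential of a change of charts at p. Both [chart_diff] and
[coord_vec] are cases in which one of the two charts is [chart_at p]. *)
Definition trans_diff c d p (v : 'cV[R]_n) : 'cV[R]_n :=
  'D_v (fwd d \o bwd c) (fwd c p).

Lemma differentiable_transition c d p :
  atlas c -> atlas d -> dom c p -> dom d p ->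
  differentiable (fwd d \o bwd c) (fwd c p).
Proof.
move=> ac ad cp dp; have [df _] := smooth_transition ac ad 1.
exact/df/overlap_fwd.
Qed.

Lemma trans_diff_comp c d e p v : atlas c -> atlas d -> atlas e ->
  dom c p -> dom d p -> dom e p ->
  trans_diff d e p (trans_diff c d p v) = trans_diff c e p v.
Proof.
move=> ac ad ae cp dp ep; rewrite /trans_diff.
have dcd := differentiable_transition ac ad cp dp.
have dde := differentiable_transition ad ae dp ep.
have pE : (fwd d \o bwd c) (fwd c p) = fwd d p by rewrite /= chart_fwdK.
have dde' := dde; rewrite -pE in dde'.
have nearE : {near fwd c p, (fwd e \o bwd d) \o (fwd d \o bwd c) =1 fwd e \o bwd c}.
  apply: filterS (nbhs_of_open (@open_overlap c d) (overlap_fwd cp dp)) => x [_ dx] /=.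
  by rewrite chart_fwdK.
rewrite -(near_eq_derive v nearE).
rewrite (deriveE v (differentiable_comp dcd dde')) (diff_comp dcd dde').
rewrite (deriveE _ dde).
rewrite (deriveE v dcd).
rewrite -pE.
by [].
Qed.

Lemma trans_diff_id c p v : dom c p -> trans_diff c c p v = v.
Proof.
move=> cp; have idE : {near fwd c p, fwd c \o bwd c =1 id}.
  apply: filterS (nbhs_of_open (@open_img c) (img_fwd cp)) => x.
  by move=> /img_bwd[].
by rewrite /trans_diff (near_eq_derive v idE) derive_id.
Qed.

Lemma chart_diffZ c p a v : atlas c -> dom c p ->
  chart_diff c p (a *: v) = a *: chart_diff c p v.
Proof.
move=> ac cp; have [aq qp] := chart_atP p.
have df := differentiable_transition aq ac qp cp.
by rewrite /chart_diff !(deriveE _ df) linearZ.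
Qed.

Lemma chart_diff_sum c p m (a : 'I_m -> R) (v : 'I_m -> 'cV[R]_n) :
  atlas c -> dom c p ->
  chart_diff c p (\sum_i a i *: v i) = \sum_i a i *: chart_diff c p (v i).
Proof.
move=> ac cp; have [aq qp] := chart_atP p.
have df := differentiable_transition aq ac qp cp.
rewrite /chart_diff (deriveE _ df) linear_sum.
by apply: eq_bigr => i _; rewrite linearZ /= (deriveE _ df).
Qed.

(** The differentials of the changes of charts between c and [chart_at p] are
inverse to each other. *)
Lemma coord_vec_basis c p v : atlas c -> dom c p ->
  v = \sum_i chart_diff c p v i 0 *: coord_vec c p i.
Proof.
move=> ac cp; have [aq qp] := chart_atP p.
have df := differentiable_transition ac aq cp qp.
rewrite -[LHS](trans_diff_id v qp) -(trans_diff_comp v aq ac aq qp cp qp).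
rewrite -[trans_diff _ c p v]/(chart_diff c p v).
rewrite /trans_diff {1}(cV_sum_delta (chart_diff c p v)) (deriveE _ df) linear_sum.
by apply: eq_bigr => i _; rewrite linearZ /= -(deriveE _ df).
Qed.

(** In the chart c, JX is the sum of the images under J of the coordinate fields,
smooth by hypothesis, weighted by the components of X. *)
Lemma vector_field_tapp (J : M -> 'M[R]_n) (X : M -> 'cV[R]_n) :
  tensor_field11 J -> vector_field X -> vector_field (tapp J X).
Proof.
move=> tJ vX c ac k; have oc := @open_img c.
pose Y j p := J p *m coord_vec c p j.
apply: (Ck_eq (f := fun x => \sum_j local_rep c X x j 0 *: local_rep c (Y j) x)) => //.
  move=> x /img_bwd[cx _].
  rewrite /local_rep /tapp -(chart_diff_sum _ _ ac cx).
  congr chart_diff; rewrite [in RHS](coord_vec_basis (X (bwd c x)) ac cx).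
  by rewrite mulmx_sumr; apply: eq_bigr => j _; rewrite -scalemxAr.
apply: Ck_sum => // j; apply: Ck_scale => //; last exact: tJ.
by apply: smooth_coord => //; exact: vX.
Qed.

Lemma vector_fieldZ (a : R) (X : M -> 'cV[R]_n) :
  vector_field X -> vector_field (fun p => a *: X p).
Proof.
move=> vX c ac k; have oc := @open_img c.
apply: (Ck_eq (f := fun x => a *: local_rep c X x)) => //.
  by move=> x /img_bwd[cx _]; rewrite /local_rep chart_diffZ.
by apply: Ck_scale => //; [exact: Ck_cst|exact: vX].
Qed.

(** Extend v to the field with constant components in a chart c around p,
multiply by a bump function supported in a cube inside the image of c, and
extend by 0. The support K is compact, hence closed since M is Hausdorff, so
that the field vanishes near each point outside K; near a point of K it is given
by the chart c. *)
Lemma vector_field_extension p (v : 'cV[R]_n) :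
  exists2 X : M -> 'cV[R]_n, vector_field X & X p = v.
Proof.
pose c := chart_at p; have [ac cp] : atlas c /\ dom c p := chart_atP p.
pose a := fwd c p.
have [r r0 rc] : exists2 r, 0 < r & cube a r `<=` img c.
  by apply: cube_nbhs; exact: nbhs_of_open (@open_img c) (img_fwd cp).
pose b := bump a r; pose b0 := (b a)^-1.
(* dividing by b a makes the cut-off factor equal to 1 at p *)
pose X q := if `[< dom c q >]
  then (b0 * b (fwd c q)) *: trans_diff c (chart_at q) q v else 0.
exists X; last first.
  rewrite /X; case: asboolP => // _; rewrite mulVf ?bump_center ?gt_eqF// scale1r.
  exact: trans_diff_id.
pose K := bwd c @` cube a r.
have cK : closed K.
  apply: compact_closed; first exact: manifold_hausdorff.
  apply: continuous_compact; last exact: cube_compact.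
  apply: continuous_in_subspaceT => x; rewrite inE => /rc; exact: chart_bwd_cont.
have X0 q : ~ K q -> X q = 0.
  move=> Kq; rewrite /X; case: asboolP => // cq.
  have [->|bq] := eqVneq (b (fwd c q)) 0; first by rewrite mulr0 scale0r.
  case: Kq; exists (fwd c q); last exact: chart_fwdK.
  exact: bump_supp (ltW r0) bq.
move=> d ad k; apply: Ck_local => x dx; have [dbx bxK] := img_bwd dx.
have [Kx|nKx] := pselect (K (bwd d x)); last first.
  exists (img d `&` bwd d @^-1` ~` K); first by [].
  have oW : open (img d `&` bwd d @^-1` ~` K).
    by apply: open_preimage; exact: closed_openC.
  apply: (Ck_eq (f := cst 0)) => //; last exact: Ck_cst.
  move=> y [/img_bwd[dy _] Ky]; rewrite /local_rep X0//.
  by rewrite -[X in chart_diff _ _ X](scale0r 0) chart_diffZ// scale0r.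
have cbx : dom c (bwd d x).
  by case: Kx => y /rc /img_bwd[cy _] <-.
exists (overlap d c); first by [].
have oW := @open_overlap d c.
pose t := fwd c \o bwd d.
apply: (Ck_eq (f := fun y => (b0 * b (t y)) *: 'D_v (fwd d \o bwd c) (t y))) => //.
  move=> y [/img_bwd[dy _] cy]; rewrite /local_rep /X; case: asboolP => // _.
  have [aq qq] := chart_atP (bwd d y).
  rewrite (chart_diffZ _ _ ad dy).
  have E := trans_diff_comp v ac aq ad cy qq dy.
  by rewrite -[chart_diff _ _ _]/(trans_diff _ _ _ _) E.
have st : smooth_on (overlap d c) t by exact: smooth_transition.
apply: Ck_scale => //.
  apply: Ck_scale => //; first exact: Ck_cst.
  by apply: (@smooth_comp _ _ _ _ _ setT) => //; exact: smooth_bump.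
apply: (@smooth_comp _ _ _ _ _ (overlap c d) t ('D_v (fwd d \o bwd c))) => //.
  by move=> y [/img_bwd[dy _] cy]; exact: overlap_fwd.
by move=> l; have [_ /(_ v)] := smooth_transition ac ad l.+1.
Qed.

End Charts.

(** * The covariant derivative of J *)

Section Pairing.
Variables (R : realType) (n : nat) (M : smoothManifold R n) (g : M -> 'M[R]_n).
Implicit Types X Y Z : M -> 'cV[R]_n.

Lemma pairingZr a X Y p : pairing g X (fun q => a *: Y q) p = a * pairing g X Y p.
Proof. by rewrite /pairing -scalemxAr mxE. Qed.

Lemma pairingBl X Y Z p :
  pairing g (fun q => X q - Y q) Z p = pairing g X Z p - pairing g Y Z p.
Proof. by rewrite /pairing [(_ - _)^T]linearB /= !mulmxBl !mxE. Qed.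

Lemma pairingC X Y p : (g p)^T = g p -> pairing g X Y p = pairing g Y X p.
Proof.
move=> gT; rewrite /pairing.
have -> : (Y p)^T *m g p *m X p = ((X p)^T *m g p *m Y p)^T.
  by rewrite !trmx_mul trmxK gT mulmxA.
by rewrite [RHS]mxE.
Qed.

End Pairing.

Section CovariantDerivative.
Variables (R : realType) (n : nat) (M : smoothManifold R n).
Variables (alpha eps : R) (J g : M -> 'M[R]_n) (nabla : connection M).
Hypothesis alpha_unit : alpha ^+ 2 = 1.
Hypothesis (hJg : alpha_eps_structure alpha eps J g).
Hypothesis (hnabla : levi_civita g nabla).
Implicit Types X Y Z : M -> 'cV[R]_n.
Local Notation S := (nabla_tensor nabla J).
Local Notation J' := (tapp J).

Lemma vector_field_J X : vector_field X -> vector_field (J' X).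
Proof. exact/vector_field_tapp/(str_tensor hJg). Qed.

Lemma tapp_sqr X : J' (J' X) = (fun q => alpha *: X q).
Proof.
by apply/funext => q; rewrite /tapp mulmxA (str_sqr hJg) mul_scalar_mx.
Qed.

(** Nondegeneracy only speaks of tangent vectors at p; each of them is the value
of a vector field. *)
Lemma metric_eq0 X p : (forall Z, vector_field Z -> pairing g X Z p = 0) -> X p = 0.
Proof.
move=> X0; have XT0 : (X p)^T *m g p = 0.
  apply/rowP => i; rewrite [RHS]mxE.
  have [Z vZ Zp] := vector_field_extension p (delta_mx i 0).
  by have := X0 _ vZ; rewrite /pairing Zp -colE mxE.
apply: trmx_inj; rewrite trmx0.
by rewrite -[LHS](mulmxK (metric_nondeg (str_metric hJg) p)) XT0 mul0mx.
Qed.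

Lemma nablaZ a X Y p : vector_field X -> vector_field Y ->
  nabla X (fun q => a *: Y q) p = a *: nabla X Y p.
Proof.
move=> vX vY; have sa : smooth_fun (fun _ : M => a) by move=> c ac k; exact: Ck_cst.
rewrite (conn_leibniz (lc_connection hnabla) sa vX vY).
by rewrite /vf_deriv (_ : _ \o _ = cst a) // derive_cst scale0r add0r.
Qed.

Lemma J_adjoint X Y p : vector_field X -> vector_field Y ->
  pairing g (J' X) Y p = alpha * eps * pairing g X (J' Y) p.
Proof.
move=> vX vY; have := str_compat hJg vX (vector_field_J vY) p.
rewrite tapp_sqr pairingZr -mulrA => <-.
by rewrite mulrA -expr2 alpha_unit mul1r.
Qed.

(** Differentiate g(JY, Z) = g(Y, sJZ) along X, with s = alpha * eps a constant
that passes through the connection by the Leibniz rule, and subtract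
the adjunction relations for (nabla_X Y, Z) and (Y, nabla_X Z). *)
Lemma nablaJ_adjoint X Y Z p :
  vector_field X -> vector_field Y -> vector_field Z ->
  pairing g (S X Y) Z p = alpha * eps * pairing g (S X Z) Y p.
Proof.
move=> vX vY vZ; have nab U : vector_field U -> vector_field (nabla X U).
  exact: conn_smooth (lc_connection hnabla) _ _ vX.
have gC U V : pairing g U V p = pairing g V U p.
  exact/pairingC/(metric_sym (str_metric hJg)).
have vsJZ := @vector_fieldZ _ _ _ (alpha * eps) _ (vector_field_J vZ).
have derivJY := lc_metric hnabla vX (vector_field_J vY) vZ p.
have derivJZ := lc_metric hnabla vX vY vsJZ p.
have E : pairing g (J' Y) Z = pairing g Y (fun q => (alpha * eps) *: J' Z q).
  by apply/funext => q; rewrite pairingZr J_adjoint.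
have nZ : pairing g Y (nabla X (fun q => (alpha * eps) *: J' Z q)) p
        = alpha * eps * pairing g Y (nabla X (J' Z)) p.
  rewrite -(pairingZr g (alpha * eps)) /pairing.
  by rewrite (nablaZ _ _ vX (vector_field_J vZ)).
rewrite -E derivJY nZ pairingZr (J_adjoint p vY (nab _ vZ)) in derivJZ.
rewrite /nabla_tensor !pairingBl (J_adjoint p (nab _ vY) vZ).
rewrite (gC (nabla X (J' Z)) Y) (gC (J' (nabla X Z)) Y).
by lra.
Qed.

(** The derivative of J^2 = alpha. *)
Lemma nablaJ_anticomm X Y p : vector_field X -> vector_field Y ->
  S X (J' Y) p = - (J p *m S X Y p).
Proof.
move=> vX vY; rewrite /nabla_tensor tapp_sqr.
by rewrite nablaZ// /tapp mulmxBr mulmxA (str_sqr hJg) mul_scalar_mx opprB.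
Qed.

(** [nablaJ_anticomm] followed by [J_adjoint]. The latter is stated for vector
fields, so J S(X, Y) is split into the difference of two of them. *)
Lemma nablaJ_skew X Y Z p : vector_field X -> vector_field Y -> vector_field Z ->
  pairing g (S X (J' Y)) Z p = - (alpha * eps * pairing g (S X Y) (J' Z) p).
Proof.
move=> vX vY vZ; have nab U : vector_field U -> vector_field (nabla X U).
  exact: conn_smooth (lc_connection hnabla) _ _ vX.
have vJY := vector_field_J vY; have vJn := vector_field_J (nab _ vY).
have -> : pairing g (S X (J' Y)) Z p = - pairing g (J' (S X Y)) Z p.
  rewrite {1}/pairing (nablaJ_anticomm p vX vY) [(- _)^T]linearN /= !mulNmx.
  by rewrite mxE.
have -> : J' (S X Y) = (fun q => J' (nabla X (J' Y)) q - J' (J' (nabla X Y)) q).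
  by apply/funext => q; rewrite /tapp mulmxBr.
rewrite !pairingBl (J_adjoint p (nab _ vJY) vZ) (J_adjoint p vJn vZ).
by rewrite mulrBr.
Qed.

End CovariantDerivative.

Theorem theorem5p1 (R : realType) (n : nat) (M : smoothManifold R n)
    (alpha eps : R) (J g : M -> 'M[R]_n) (nabla : connection M)
    (halpha : alpha = 1 \/ alpha = -1) (heps : eps = 1 \/ eps = -1)
    (hJg : alpha_eps_structure alpha eps J g)
    (hnabla : levi_civita g nabla)
    (hcodazzi : forall X Y : M -> 'cV[R]_n,
       vector_field X -> vector_field Y ->
       forall p : M,
         nabla_tensor nabla J X Y p - nabla_tensor nabla J Y X p = 0) :
  kahler_type nabla J.
Proof.
have alpha2 : alpha ^+ 2 = 1 by case: halpha => ->; rewrite ?sqrrN expr1n.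
move=> X Y vX vY p; apply: (metric_eq0 hJg) => Z vZ.
pose T A B C := pairing g (nabla_tensor nabla J A B) C p.
have sym12 A B C : vector_field A -> vector_field B -> T A B C = T B A C.
  move=> vA vB; have /eqP := hcodazzi A B vA vB p.
  by rewrite subr_eq0 => /eqP E; rewrite /T /pairing E.
have sym23 A B C : vector_field A -> vector_field B -> vector_field C ->
    T A B C = alpha * eps * T A C B.
  by move=> vA vB vC; exact: (nablaJ_adjoint alpha2 hJg hnabla).
have [s1|sN1] : alpha * eps = 1 \/ alpha * eps = -1.
- by case: halpha heps => -> [] ->; [left|right|right|left]; ring.
- have vJ := @vector_field_J _ _ _ _ _ _ _ hJg.
  have skewJ A B C : vector_field A -> vector_field B -> vector_field C ->
      T A B (tapp J C) = - T A (tapp J B) C.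
    move=> vA vB vC; rewrite /T.
    by rewrite (nablaJ_skew alpha2 hJg hnabla)// s1 mul1r opprK.
  (* J moves from W to Y, from Y to X and back to W: three sign changes *)
  have TJ0 W : vector_field W -> T X Y (tapp J W) = 0.
    move=> vW; suff : T X Y (tapp J W) = - T X Y (tapp J W) by lra.
    have vJX := vJ _ vX; have vJY := vJ _ vY; have vJW := vJ _ vW.
    rewrite {1}skewJ// sym12// sym23// s1 mul1r sym12// -skewJ// sym12// skewJ//.
    by rewrite sym23// s1 mul1r sym12.
  have TZ : alpha * T X Y Z = 0.
    by rewrite -(TJ0 _ (vJ _ vZ)) (tapp_sqr hJg) /T pairingZr.
  have -> : pairing g (nabla_tensor nabla J X Y) Z p = alpha * (alpha * T X Y Z).
    by rewrite mulrA -expr2 alpha2 mul1r.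
  by rewrite TZ mulr0.
- suff : T X Y Z = - T X Y Z by rewrite /T; lra.
  rewrite {1}sym23// sN1 mulN1r sym12// sym23// sN1 mulN1r opprK sym12//.
  by rewrite sym23// sN1 mulN1r sym12.
Qed.
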